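(* Let $D$ be a bipartite weighted oriented graph with underlying graph $G$. Then $I(D)$ is unmixed if and only if the following two conditions hold: 1) $G$ has a perfect matching $\{\{x_1^1,x_1^2\},\dots,\{x_s^1,x_s^2\}\}$, where $\{x_1^1,\dots,x_s^1\}$ and $\{x_1^2,\dots,x_s^2\}$ are stable sets. Furthermore, if $\{x_j^1,x_i^2\},\{x_i^1,x_k^2\}\in E(G)$, then $\{x_j^1,x_k^2\}\in E(G)$. 2) (With the labelling of 1).) If $w(x_j^k)\neq 1$ and $N_D^{+}(x_j^k)=\{x_{i_1}^{k'},\dots,x_{i_r}^{k'}\}$, where $\{k,k'\}=\{1,2\}$, then $N_D(x_{i_\ell}^k)\subseteq N_D^{+}(x_j^k)$ and $N_D^{-}(x_{i_\ell}^k)\cap V^{+}=\emptyset$ for each $1\le\ell\le r$.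
   Context: A weighted oriented graph is a triplet $D=(V(D),E(D),w)$ where $V=V(D)$ is a finite set, $E=E(D)\subseteq V\times V$ is the edge set of an oriented graph (no loops, and for $x\neq y$ at most one of $(x,y),(y,x)$ is in $E$), and $w:V\to\mathbb{N}=\{1,2,\dots\}$ is the weight function. Its underlying graph $G$ is the simple graph on $V$ with edge set $E(G)=\{\{x,y\}:(x,y)\in E\}$; $D$ is bipartite if $G$ is bipartite. Put $V^{+}=\{x\in V: w(x)\neq 1\}$. For $x\in V$: $N_D^{+}(x)=\{y:(x,y)\in E\}$, $N_D^{-}(x)=\{y:(y,x)\in E\}$, $N_D(x)=N_D^+(x)\cup N_D^-(x)$. A source is a vertex $x$ with $N_D(x)=N_D^+(x)$. Standing assumption: if $x$ is a source of $D$, then $w(x)=1$. A stable set is a set of pairwise non-adjacent vertices. A perfect matching of $G$ is a set of pairwise disjoint edges of $G$ whose union is $V$. The edge ideal $I(D)$ is the ideal of the polynomial ring over a field $K$ whose variables are the vertices of $D$, generated by the monomials $ab^{w(b)}$ for $(a,b)\in E$. An ideal is unmixed if all its associated primes have the same height.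
   Formalization: The graph G is assumed to have no isolated vertices; without this the ''only if'' fails, e.g. for a single vertex with no edges, where I(D)=0 is unmixed but G has no perfect matching. *)

(* Defs.v *)
From HB Require Import structures.
From mathcomp Require Import all_boot all_order all_algebra.
From mathcomp Require Import mpoly.

Set Implicit Arguments.
Unset Strict Implicit.
Unset Printing Implicit Defensive.

Import GRing.Theory.
Local Open Scope ring_scope.

(* Ideals of a commutative ring, as Prop-valued predicates. (The predicates of
   ring_quotient are boolean, and membership in a generated ideal is not.) *)

Section Ideals.
Variable R : comNzRingType.
Implicit Types (I P Q S : R -> Prop) (C : nat -> R -> Prop).

Definition is_ideal I : Prop :=
  [/\ I 0, forall f g, I f -> I g -> I (f + g) & forall a f, I f -> I (a * f)].

Definition ideal_gen S : R -> Prop :=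
  fun f => forall I, is_ideal I -> (forall g, S g -> I g) -> I f.

Definition is_prime_ideal P : Prop :=
  [/\ is_ideal P, ~ P 1 & forall f g, P (f * g) -> P f \/ P g].

Definition is_assoc_prime I P : Prop :=
  is_prime_ideal P /\ exists f, forall g, P g <-> I (g * f).

Definition strictly_below P Q : Prop :=
  (forall f, P f -> Q f) /\ exists2 f, Q f & ~ P f.

(* C 0 < ... < C n = P is a chain of n + 1 prime ideals, that is of length n;
   the values of C beyond n are irrelevant. *)
Definition prime_chain n C P : Prop :=
  [/\ forall i, (i <= n)%N -> is_prime_ideal (C i),
      forall i, (i < n)%N -> strictly_below (C i) (C i.+1)
    & forall f, C n f <-> P f].

Definition has_height P (h : nat) : Prop :=
  (exists C, prime_chain h C P) /\
  (forall n C, prime_chain n C P -> (n <= h)%N).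

(* Equality of heights in the extended naturals: a prime of infinite height is
   one for which [has_height P h] fails for all h. *)
Definition unmixed I : Prop :=
  forall P Q, is_assoc_prime I P -> is_assoc_prime I Q ->
  forall h, has_height P h <-> has_height Q h.

End Ideals.

Record wograph (V : finType) := WOGraph {
  arc : rel V;
  weight : V -> nat;
  arc_irr : irreflexive arc;
  arc_asym : forall x y, arc x y -> ~~ arc y x;
  weight_gt0 : forall x, (0 < weight x)%N
}.

Section WeightedOrientedGraphs.
Variables (V : finType) (D : wograph V).

Definition Vplus : {set V} := [set x | weight D x != 1%N].

Definition Nout (x : V) : {set V} := [set y | arc D x y].
Definition Nin (x : V) : {set V} := [set y | arc D y x].
Definition Nbr (x : V) : {set V} := Nout x :|: Nin x.

Definition source (x : V) : bool := Nbr x == Nout x.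

Definition adj : rel V := [rel x y | arc D x y || arc D y x].

Definition edges : {set {set V}} :=
  [set [set p.1; p.2] | p in [set p : V * V | arc D p.1 p.2]].

Definition stable (A : {set V}) : Prop :=
  forall x y, x \in A -> y \in A -> ~~ adj x y.

Definition bipartite : Prop :=
  exists A B : {set V},
    [/\ stable A, stable B, A :|: B = [set: V] & [disjoint A & B]].

Definition perfect_matching (M : {set {set V}}) : Prop :=
  [/\ M \subset edges, trivIset M & cover M = [set: V]].

(* [x k j] stands for x_j^k, with k = false for the superscript 1 and k = true
   for the superscript 2, so that the other superscript k' is [~~ k]. *)
Section Labelling.
Variables (s : nat) (x : bool -> 'I_s -> V).

Definition matched_pair (i : 'I_s) : {set V} := [set x false i; x true i].

Definition matching_condition : Prop :=
  [/\ injective matched_pair,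
      perfect_matching [set matched_pair i | i : 'I_s],
      forall k, stable [set x k i | i : 'I_s]
    & forall i j k : 'I_s,
        adj (x false j) (x true i) -> adj (x false i) (x true k) ->
        adj (x false j) (x true k)].

(* L is the set of indices i_1, ..., i_r. *)
Definition weight_condition : Prop :=
  forall (k : bool) (j : 'I_s) (L : {set 'I_s}),
    weight D (x k j) <> 1%N ->
    Nout (x k j) = [set x (~~ k) i | i in L] ->
    forall i, i \in L ->
      Nbr (x k i) \subset Nout (x k j) /\ Nin (x k i) :&: Vplus = set0.

End Labelling.

(* The variable attached to the vertex v is the one of index [enum_rank v]. *)
Definition arc_monomial (K : fieldType) (a b : V) : {mpoly K[#|V|]} :=
  'X_(enum_rank a) * 'X_(enum_rank b) ^+ weight D b.

Definition edge_ideal (K : fieldType) : {mpoly K[#|V|]} -> Prop :=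
  ideal_gen (fun f => exists a b, arc D a b /\ f = arc_monomial K a b).

End WeightedOrientedGraphs.

Arguments arc_monomial {V} D K a b.
Arguments edge_ideal {V} D K _.

(* Main.v *)
(* Algebra.  An associated prime of a monomial ideal I is generated by variables
   and has the form (I : X^m).  The prime generated by a set A of variables has
   height #|A|: it sits in a chain of primes of length n, the number of
   variables, and no chain of primes is longer, since the residue ring of the
   k-th prime from the top contains d^k linearly independent classes of
   polynomials whose exponents are O(d).  For I = I(D), the sets of variables
   outside these primes are certain stable sets S of vertices ([assoc_set]), and
   unmixedness says that they all have the same size.

   Combinatorics.  Suppose that the sizes agree.  Both sides of the bipartition
   are such sets, and every stable set extends to one, so Hall's theorem gives a
   perfect matching and every such S meets every edge of the matching.  Were the
   transitivity condition or the weight condition to fail, one could construct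
   such an S missing both ends of some matching edge.  Conversely, the two
   conditions force S to meet every matching edge, so that #|S| = s. *)

Require Import Defs.
From HB Require Import structures.
From mathcomp Require Import all_boot all_order all_algebra.
From mathcomp Require Import mpoly ring zify.
From Stdlib Require Import Classical.
(* path.v also defines arc, which would shadow the one of Defs. *)
Import Defs.

Set Implicit Arguments.
Unset Strict Implicit.
Unset Printing Implicit Defensive.

Import Order.TTheory GRing.Theory.
Local Open Scope ring_scope.

(** * Monomial ideals and their associated primes *)

Lemma ideal_sum (R : comNzRingType) (I : R -> Prop) (T : Type) (r : seq T)
    (P : pred T) (F : T -> R) :
  is_ideal I -> (forall i, P i -> I (F i)) -> I (\sum_(i <- r | P i) F i).
Proof. by case=> I0 ID _ IF; apply: big_ind. Qed.

Lemma ideal_mull (R : comNzRingType) (I : R -> Prop) (a f : R) :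
  is_ideal I -> I f -> I (a * f).
Proof. by case=> _ _; apply. Qed.

Lemma ideal_sub (R : comNzRingType) (I : R -> Prop) (f g : R) :
  is_ideal I -> I f -> I g -> I (f - g).
Proof. by case=> _ ID IM If Ig; rewrite -mulN1r; apply: ID => //; apply: IM. Qed.

Lemma ideal_gen_is_ideal (R : comNzRingType) (S : R -> Prop) : is_ideal (ideal_gen S).
Proof.
split=> [|f g If Ig|a f If] I idI SI; have [I0 ID IM] := idI => //.
  by apply: ID; [apply: If | apply: Ig].
by apply: IM; apply: If.
Qed.

Lemma eq_assoc_prime (R : comNzRingType) (I J P : R -> Prop) :
  (forall f, I f <-> J f) -> is_assoc_prime I P -> is_assoc_prime J P.
Proof. by move=> IJ [pP [f Pf]]; split=> //; exists f => g; rewrite Pf IJ. Qed.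

Section MonomialIdeals.
Variables (n : nat) (K : fieldType).
Implicit Types (B : pred 'X_{1..n}) (m u : 'X_{1..n}) (f g : {mpoly K[n]}).
Implicit Types (A : {set 'I_n}).

Definition upclosed B : Prop := forall m u, B m -> B (m + u)%MM.

(** The K-span of the monomials with exponent in [B]; it is an ideal once [B] is [upclosed]. *)
Definition mono_ideal B f : Prop := {in msupp f, forall m, B m}.

Lemma mono_ideal_is_ideal B : upclosed B -> is_ideal (mono_ideal B).
Proof.
move=> upB; split=> [m|f g If Ig m|a f If m].
- by rewrite msupp0.
- by move/msuppD_le; rewrite mem_cat => /orP[/If|/Ig].
- by move/msuppM_le/allpairsP=> [[u v]] /= [_ /If Bv ->]; rewrite addmC upB.
Qed.

Lemma ideal_scale (I : {mpoly K[n]} -> Prop) c f : is_ideal I -> I f -> I (c *: f).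
Proof. by move=> idI If; rewrite -mul_mpolyC; apply: ideal_mull. Qed.

Lemma mono_idealX B m : mono_ideal B 'X_[m] <-> B m.
Proof.
split; first by apply; apply/mem_msuppXP.
by move=> Bm u /mem_msuppXP<-.
Qed.

Lemma mono_idealMX B f m :
  mono_ideal B (f * 'X_[m]) <-> {in msupp f, forall u, B (m + u)%MM}.
Proof.
split=> [If u fu|If v].
  by apply: If; rewrite (perm_mem (msuppMX f m)); apply: map_f.
by rewrite (perm_mem (msuppMX f m)) => /mapP[u /If Bu ->].
Qed.

Lemma mono_ideal_gen B f (I : {mpoly K[n]} -> Prop) :
  is_ideal I -> (forall m, B m -> I 'X_[m]) -> mono_ideal B f -> I f.
Proof.
move=> idI IX If; rewrite (mpolyE f) big_seq; apply: ideal_sum => // m /If Bm.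
by apply: ideal_scale => //; apply: IX.
Qed.

Definition meets A m : bool := [exists i in A, m i != 0%N].

Definition var_ideal A : {mpoly K[n]} -> Prop := mono_ideal (meets A).

Lemma meets_addl A m u : meets A (m + u)%MM = meets A m || meets A u.
Proof.
apply/existsP/orP => [[i /andP[Ai]]|].
  rewrite mnmDE addn_eq0 negb_and => /orP[mi|ui]; [left|right];
    by apply/existsP; exists i; rewrite Ai.
by case=> /existsP[i /andP[Ai mi]]; exists i; rewrite Ai mnmDE addn_eq0 negb_and mi ?orbT.
Qed.

Lemma meets_upclosed A : upclosed (meets A).
Proof. by move=> m u Am; rewrite meets_addl Am. Qed.

Lemma meetsU A i : meets A U_(i)%MM = (i \in A).
Proof.
apply/existsP/idP => [[j /andP[Aj]]|Ai]; last by exists i; rewrite Ai mnm1E eqxx.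
by rewrite mnm1E; have [->|] := eqVneq i j.
Qed.

Lemma meetsPn A m : reflect (forall i, i \in A -> m i = 0%N) (~~ meets A m).
Proof.
apply: (iffP idP) => [/existsPn Am i Ai|Am].
  by have := Am i; rewrite Ai /= negbK => /eqP.
by apply/existsPn => i; case Ai: (i \in A); rewrite //= Am.
Qed.

Lemma var_ideal_is_ideal A : is_ideal (var_ideal A).
Proof. exact/mono_ideal_is_ideal/meets_upclosed. Qed.

Lemma var_idealX A m : var_ideal A 'X_[m] <-> meets A m.
Proof. exact: mono_idealX. Qed.

(** Keeping only the terms of [f] free of the variables of [A] gives its class in the polynomial
    ring on the remaining variables. *)
Lemma var_ideal_residue A f : ~ var_ideal A f ->
  exists g, [/\ g != 0, {in msupp g, forall m, ~~ meets A m} & var_ideal A (f - g)].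
Proof.
move=> nAf; pose g : {mpoly K[n]} :=
  \sum_(m <- msupp f | ~~ meets A m) f@_m *: 'X_[m].
have gE : forall m, g@_m = if meets A m then 0 else f@_m.
  move=> m; rewrite /g raddf_sum /=.
  under eq_bigr do rewrite mcoeffZ mcoeffX.
  have [fm|fm] := boolP (m \in msupp f); last first.
    rewrite (memN_msupp_eq0 fm) if_same big_seq_cond big1 // => u /andP[fu _].
    by case: eqP => [um|]; [rewrite um (negPf fm) in fu | rewrite mulr0].
  rewrite big_mkcond (bigD1_seq m) ?msupp_uniq //= eqxx mulr1.
  rewrite big1 ?addr0 ?if_neg // => u /negPf->.
  by rewrite mulr0 if_same.
have Afg : var_ideal A (f - g).
  move=> m; rewrite mcoeff_msupp mcoeffB gE; case: (meets A m) => //.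
  by rewrite subrr eqxx.
exists g; split=> //.
  by apply: contra_notN nAf => /eqP g0; move: Afg; rewrite g0 subr0.
by move=> m; rewrite mcoeff_msupp gE; case: (meets A m) => //; rewrite eqxx.
Qed.

(** Modulo the ideal, both factors may be taken free of the variables of [A]; the leading monomial
    of their product is then free of them too. *)
Lemma var_ideal_prime A : is_prime_ideal (var_ideal A).
Proof.
have idA := var_ideal_is_ideal A; split=> //.
  rewrite -mpolyX0 => /var_idealX /existsP[i /andP[_]].
  by rewrite mnm0E eqxx.
move=> f g Afg; suff nn : ~ (~ var_ideal A f /\ ~ var_ideal A g).
  have [/allP|] := boolP (all (meets A) (msupp f)); first by left.
  have [/allP|] := boolP (all (meets A) (msupp g)); first by right.
  by move=> ng nf; case: nn; split=> /allP Am; [rewrite Am in nf | rewrite Am in ng].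
case=> /var_ideal_residue[f0 [f0n Af0 Aff0]] /var_ideal_residue[g0 [g0n Ag0 Agg0]].
have : var_ideal A (f0 * g0).
  have -> : f0 * g0 = f * g - (g * (f - f0) + f0 * (g - g0)).
    by ring.
  apply: (ideal_sub idA) => //; case: idA => _ AD AM.
  by apply: AD; apply: AM.
move/(_ (mlead (f0 * g0)) (mlead_supp (mulf_neq0 f0n g0n))).
rewrite mleadM // meets_addl (negPf (Af0 _ (mlead_supp f0n))).
by rewrite (negPf (Ag0 _ (mlead_supp g0n))).
Qed.

Lemma var_ideal_strict A A' : A \proper A' ->
  strictly_below (var_ideal A) (var_ideal A').
Proof.
case/properP=> /subsetP sAA' [i iA' iA]; split.
  move=> f Af m /Af /existsP[j /andP[Aj mj]].
  by apply/existsP; exists j; rewrite sAA'.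
exists 'X_i; first by apply/var_idealX; rewrite meetsU.
by move/var_idealX; rewrite meetsU; apply/negP.
Qed.

(* The condition for (mono_ideal B : X^m) to be the prime (X_i | i \in A). *)
Definition colon_witness B A m : Prop :=
  (forall u, ~~ meets A u -> ~~ B (m + u)%MM) /\ 
  (forall i, i \in A -> B (m + U_(i))%MM).

Lemma upclosedU B A m u : upclosed B ->
  (forall i, i \in A -> B (m + U_(i))%MM) -> meets A u -> B (m + u)%MM.
Proof.
move=> upB Bi /existsP[i /andP[Ai ui]].
have -> : u = (U_(i) + (u - U_(i)))%MM.
  by rewrite addmC submK // lep1mP.
by rewrite addmA; apply/upB/Bi.
Qed.

(** The colon of a monomial ideal by a monomial is again monomial, so it can be tested on
    exponents. *)
Lemma witness_assoc B A m : upclosed B -> colon_witness B A m ->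
  is_assoc_prime (mono_ideal B) (var_ideal A).
Proof.
move=> upB [nB Bi]; split; first exact: var_ideal_prime.
exists 'X_[m] => g; rewrite mono_idealMX; split=> Ag u /Ag.
  exact: upclosedU.
by apply: contraLR => /nB.
Qed.

(* If f has the least number of terms among the polynomials with (I : f) = P,
   then a monomial X^u killing one term of f lies in P, for otherwise X^u * f
   without its killed terms would be shorter. *)
Lemma assoc_short B (P : {mpoly K[n]} -> Prop) : upclosed B ->
  is_assoc_prime (mono_ideal B) P ->
  exists f, (forall g, P g <-> mono_ideal B (g * f)) /\
    forall u m, m \in msupp f -> B (m + u)%MM -> P 'X_[u].
Proof.
move=> upB [[idP nP1 Pp] [f]].
have [k] := ubnP (size (msupp f)); elim: k f => // k IHk f /ltnSE lefk Pf.
have [[u [m [fm Bmu nPu]]]|short] := classic (exists u m,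
    [/\ m \in msupp f, B (m + u)%MM & ~ P 'X_[u]]); last first.
  exists f; split=> // u m fm Bmu; apply: NNPP => nPu.
  by apply: short; exists u, m.
(* The dropped term times X^u lies in the ideal, and X^u can be cancelled because P is prime and
   does not contain it; so the shorter polynomial has the same colon P. *)
pose f1 := f - f@_m *: 'X_[m].
apply: (IHk (f1 * 'X_[u])).
  rewrite (perm_size (msuppMX _ _)) size_map (perm_size (msupp_rem _ _)).
  by rewrite size_rem // prednK //; case: (msupp f) fm.
have idB := mono_ideal_is_ideal upB => g.
have -> : g * (f1 * 'X_[u]) = g * 'X_[u] * f - (f@_m *: g) * 'X_[m + u].
  by rewrite /f1 mpolyXD -!mul_mpolyC; ring.
have Im : mono_ideal B ((f@_m *: g) * 'X_[m + u]).
  by apply: (ideal_mull _ idB); apply/mono_idealX.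
split=> [Pg|Ig].
  apply: (ideal_sub idB) => //; rewrite -mulrA mulrCA.
  by apply: (ideal_mull _ idB); apply/Pf.
have /Pf/Pp[] // : mono_ideal B (g * 'X_[u] * f).
rewrite -[X in mono_ideal B X](subrK ((f@_m *: g) * 'X_[m + u])).
by case: idB => _ ID _; apply: ID.
Qed.

(** For [f] as in [assoc_short], X^u lies in P exactly when X^u times the leading monomial of [f]
    lies in the ideal, so that monomial can replace [f]. P is then a monomial ideal, and being prime
    it is generated by variables. *)
Lemma assoc_witness B (P : {mpoly K[n]} -> Prop) : upclosed B ->
  is_assoc_prime (mono_ideal B) P ->
  exists A m, colon_witness B A m /\ forall g, P g <-> var_ideal A g.
Proof.
move=> upB assP; have [f [Pf short]] := assoc_short upB assP.
case: assP => -[idP nP1 Pp] _; have idB := mono_ideal_is_ideal upB.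
have f0 : f != 0.
  by apply/eqP => f0; apply/nP1/Pf; rewrite f0 mulr0; case: idB.
have PXE u : P 'X_[u] <-> B (mlead f + u)%MM.
  split=> [/Pf|]; last by apply: short; apply: mlead_supp.
  by rewrite mulrC => /mono_idealMX /(_ _ (mlead_supp f0)); rewrite addmC.
have Pmono g : P g -> forall u, u \in msupp g -> P 'X_[u].
  have [k] := ubnP (size (msupp g)); elim: k g => // k IHk g /ltnSE legk Pg.
  have [->|g0] := eqVneq g 0; first by move=> u; rewrite msupp0.
  (* The leading monomial of g * f occurs in a member of the ideal. The leading term of [g] is then
     removed and the induction continues. *)
  have Plead : P 'X_[mlead g].
    apply/PXE; rewrite addmC; move/Pf: Pg; apply.
    by rewrite -mleadM // mlead_supp // mulf_neq0.
  have gl := mlead_supp g0.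
  pose g1 := g - g@_(mlead g) *: 'X_[mlead g] => u gu.
  have [->//|ul] := eqVneq u (mlead g).
  have g1s := msupp_rem g (mlead g); apply: (IHk g1).
  - rewrite (perm_size g1s) size_rem //.
    by case: (msupp g) gl legk => //= a s _; rewrite ltnS => /leq_trans; apply.
  - by apply: (ideal_sub idP) => //; apply: (ideal_scale _ idP).
  - by rewrite (perm_mem g1s) (mem_rem_uniq _ (msupp_uniq g)) !inE ul.
have PX u : P 'X_[u] -> exists2 i, B (mlead f + U_(i))%MM & u i != 0%N.
  rewrite mpolyXE_id => Pu.
  have : exists2 i, P ('X_i ^+ u i) & true.
    elim/big_rec: _ Pu => [//|i x _ IH /Pp[Pi|/IH//]].
    by exists i.
  case=> i Pi _; case ui: (u i) Pi => [|k]; first by rewrite expr0.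
  move=> Pi; exists i; rewrite ?ui //; apply/PXE.
  elim: k.+1 Pi => [|j IHj]; first by rewrite expr0.
  by rewrite exprS => /Pp[].
exists [set i | B (mlead f + U_(i))%MM], (mlead f); split; first split.
- move=> u /meetsPn Au; apply/negP => /PXE/PX[i Bi].
  by rewrite Au ?inE // eqxx.
- by move=> i; rewrite inE.
move=> g; split=> [Pg u gu|Ag].
  have [i Bi ui] := PX _ (Pmono _ Pg _ gu).
  by apply/existsP; exists i; rewrite inE Bi.
apply: (mono_ideal_gen idP _ Ag) => u Au; apply/PXE.
by apply: upclosedU Au => // i; rewrite inE.
Qed.
End MonomialIdeals.

(** * Heights *)

Section Dimension.
Variables (n : nat) (K : fieldType).
Implicit Types (P Q : {mpoly K[n]} -> Prop) (f g : {mpoly K[n]}).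

(** Bounding each exponent, rather than the total degree, leaves exactly (b + 1)^n monomials to
    count. *)
Definition boxed b f : Prop := forall m, m \in msupp f -> forall i, (m i <= b)%N.

Lemma boxedM b c f g : boxed b f -> boxed c g -> boxed (b + c) (f * g).
Proof.
move=> bf cg m /msuppM_le/allpairsP[[u v]] /= [/bf uf /cg vg ->] i.
by rewrite mnmDE leq_add.
Qed.

Lemma boxed1 b : boxed b 1.
Proof. by move=> m; rewrite msupp1 inE => /eqP-> i; rewrite mnm0E. Qed.

Lemma boxedX b f k : boxed b f -> boxed (k * b) (f ^+ k).
Proof.
move=> bf; elim: k => [|k IHk]; first exact: boxed1.
by rewrite exprS mulSn; apply: boxedM.
Qed.

Lemma boxedW b c f : (b <= c)%N -> boxed b f -> boxed c f.
Proof. by move=> lebc bf m /bf fm i; apply: leq_trans lebc. Qed.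

Lemma boxed_exists f : exists b, boxed b f.
Proof.
exists (msize f) => m /msize_mdeg_lt/ltnW lem i; apply: leq_trans lem.
by rewrite mdegE (bigD1 i) //= leq_addr.
Qed.

Definition free_mod P (T : finType) (F : T -> {mpoly K[n]}) : Prop :=
  forall c : T -> K, P (\sum_t c t *: F t) -> forall t, c t = 0.

(* A substitute for "the residue ring of P has transcendence degree >= k": the
   polynomials F t stand for the monomials in k algebraically independent
   elements with exponents below d. *)
Definition growth P (k : nat) : Prop :=
  exists e, forall d, exists (T : finType) (F : T -> {mpoly K[n]}),
    [/\ #|T| = (d ^ k)%N, free_mod P F & forall t, boxed (d * e) (F t)].

Lemma growth0 P : is_prime_ideal P -> growth P 0.
Proof.
case=> idP nP1 _; exists 0%N => d; exists unit, (fun=> 1); split=> [|c|_].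
- by rewrite card_unit.
- rewrite (bigD1 tt) //= big1 ?addr0 => [Pc []|[]//].
  apply/eqP/negPn/negP => c0; apply: nP1.
  by rewrite -[1]scale1r -(mulVf c0) -scalerA; apply: (ideal_scale _ idP).
- exact: boxed1.
Qed.

(* If f lies in Q but not in P, then modulo Q only the lowest power of f
   survives in a combination of the f ^+ i * F t. *)
Lemma free_mod_powers P Q (T : finType) (F : T -> {mpoly K[n]}) f d
    (c : nat -> T -> K) :
  is_prime_ideal P -> is_prime_ideal Q -> (forall g, P g -> Q g) ->
  Q f -> ~ P f -> free_mod Q F ->
  P (\sum_(i < d) f ^+ i * \sum_t c i t *: F t) ->
  forall i t, (i < d)%N -> c i t = 0.
Proof.
move=> [idP _ primeP] [idQ _ _] sPQ Qf nPf frF.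
elim: d c => // d IHd c; rewrite big_ord_recl mul1r.
set G := \sum_t _; set S := \sum_(i < d) _.
have -> : S = f * \sum_(i < d) f ^+ i * \sum_t c i.+1 t *: F t.
  rewrite mulr_sumr; apply: eq_bigr => i _.
  by rewrite mulrA -exprS lift0.
set S' := \sum_(i < d) _ => PG.
have c0 : forall t, c 0%N t = 0.
  apply: frF; rewrite -/G -[G](addrK (f * S')); apply: (ideal_sub idQ); first exact: sPQ.
  by rewrite mulrC; apply: (ideal_mull _ idQ).
have G0 : G = 0 by apply: big1 => t _; rewrite c0 scale0r.
rewrite G0 add0r in PG; case/primeP: PG => // PS' [|i] t lti; first exact: c0.
exact: (IHd (fun i => c i.+1)).
Qed.

(** The new family consists of the f ^+ i * F t with i < d, where f lies in Q but not in P. If the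
    exponents of f are at most b, the constant e grows to b + e. *)
Lemma growthS P Q k : is_prime_ideal P -> is_prime_ideal Q ->
  strictly_below P Q -> growth Q k -> growth P k.+1.
Proof.
move=> primeP primeQ [sPQ [f Qf nPf]] [e gQ].
have [b bf] := boxed_exists f.
exists (b + e)%N => d; have [T [F [cT frF bF]]] := gQ d.
exists ('I_d * T)%type, (fun it : 'I_d * T => f ^+ it.1 * F it.2).
split=> [|c Pc [i t]|[i t]] /=.
- by rewrite card_prod card_ord cT expnS.
(* For d = 0 there is no index; for d > 0, [inord] makes the coefficients functions of a natural
   number, as [free_mod_powers] expects. *)
- case: d c Pc i {gQ cT bF} => [|d] c Pc i; first by case: i.
  rewrite -[i]inord_val.
  apply: (@free_mod_powers P Q T F f d.+1 (fun i t => c (inord i, t))) => //.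
  suff <- : \sum_it c it *: (f ^+ it.1 * F it.2) =
            \sum_(j < d.+1) f ^+ j * \sum_u c (inord j, u) *: F u by [].
  transitivity (\sum_(j < d.+1) \sum_u c (j, u) *: (f ^+ j * F u)).
    by rewrite pair_bigA; apply: eq_bigr => -[].
  apply: eq_bigr => j _; rewrite mulr_sumr; apply: eq_bigr => u _.
  by rewrite scalerAr inord_val.
- rewrite mulnDr; apply: boxedM => //.
  by apply: boxedW (boxedX bf); rewrite leq_mul2r ltnW ?orbT.
Qed.

(** Since P contains 0, independence modulo P gives linear independence, so the matrix of
    coefficients on the monomials of the box is row free. *)
Lemma free_mod_card P (T : finType) (F : T -> {mpoly K[n]}) b :
  P 0 -> free_mod P F -> (forall t, boxed b (F t)) -> (#|T| <= b.+1 ^ n)%N.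
Proof.
move=> P0 frF bF; pose U := {ffun 'I_n -> 'I_b.+1}.
pose M : 'M[K]_(#|T|, #|U|) :=
  \matrix_(t, a) (F (enum_val t))@_[multinom ((enum_val a : U) i : nat) | i < n].
have -> : (b.+1 ^ n = #|U|)%N by rewrite card_ffun !card_ord.
suff /eqP <- : row_free M by apply: rank_leq_col.
rewrite -kermx_eq0; apply/rowV0P => v /sub_kermxP vM.
have v0 : forall t, v 0 (enum_rank t) = 0.
  apply: frF; suff -> : \sum_t v 0 (enum_rank t) *: F t = 0 by [].
  apply/mpolyP => m; rewrite mcoeff0 raddf_sum /=.
  have [/forallP mb|/forallPn[i mi]] := boolP [forall i, (m i < b.+1)%N]; last first.
    apply: big1 => t _; rewrite mcoeffZ memN_msupp_eq0 ?mulr0 //.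
    by apply: contraNN mi => /bF; apply.
  have /matrixP/(_ 0 (enum_rank [ffun i => Ordinal (mb i)])) := vM.
  rewrite !mxE (reindex enum_rank) /=; last exact: onW_bij (enum_rank_bij _).
  move=> E; rewrite -[RHS]E; apply: eq_bigr => t _; rewrite mxE mcoeffZ !enum_rankK.
  by congr (_ * _@__); apply/mnmP => i; rewrite mnmE ffunE.
by apply/rowP => j; rewrite mxE -(enum_valK j) v0.
Qed.

Lemma growth_le P k : P 0 -> growth P k -> (k <= n)%N.
Proof.
move=> P0 [e gP]; rewrite leqNgt; apply/negP => ltnk.
(* With d > (e + 1)^n and k > n: (d e + 1)^n <= d^n (e + 1)^n < d^(n + 1) <= d^k, against
   [free_mod_card]. *)
pose d := (e.+1 ^ n).+1; have [T [F [cT frF bF]]] := gP d.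
have := free_mod_card P0 frF bF; rewrite cT leqNgt => /negP; apply.
apply: (@leq_ltn_trans ((d * e.+1) ^ n)).
  by case: (n) => // n'; rewrite leq_exp2r // mulnS -[X in (X <= _)%N]add1n leq_add2r.
rewrite expnMn; apply: (@leq_trans (d ^ n.+1)); last by rewrite leq_pexp2l.
by rewrite expnS mulnC ltn_pmul2r // expn_gt0.
Qed.

Lemma chain_growth k (C : nat -> {mpoly K[n]} -> Prop) :
  (forall i, (i <= k)%N -> is_prime_ideal (C i)) ->
  (forall i, (i < k)%N -> strictly_below (C i) (C i.+1)) -> growth (C 0%N) k.
Proof.
elim: k C => [|k IHk] C pC sC; first exact/growth0/pC.
apply: (growthS (pC _ _) (pC 1%N _) (sC _ _)) => //.
by apply: (IHk (fun i => C i.+1)) => i; [apply: (pC i.+1) | apply: (sC i.+1)].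
Qed.

Lemma chain_length k (C : nat -> {mpoly K[n]} -> Prop) :
  (forall i, (i <= k)%N -> is_prime_ideal (C i)) ->
  (forall i, (i < k)%N -> strictly_below (C i) (C i.+1)) -> (k <= n)%N.
Proof.
move=> pC sC; apply: growth_le (chain_growth pC sC).
by have [[]] := pC 0%N isT.
Qed.

Section Flag.
Variable A : {set 'I_n}.

(** The elements of [A] are listed first, so that the flag passes through [A] at step #|A| and
    reaches all variables at step n. *)
Definition flag i : {set 'I_n} := [set x in take i (enum A ++ enum (~: A))].

Let uniq_flag : uniq (enum A ++ enum (~: A)).
Proof.
rewrite cat_uniq !enum_uniq andbT /=; apply/hasPn => x.
by rewrite !mem_enum inE.
Qed.

Let size_flag : size (enum A ++ enum (~: A)) = n.
Proof. by rewrite size_cat -!cardE cardsC card_ord. Qed.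

Lemma flag_card : flag #|A| = A.
Proof. by apply/setP => x; rewrite inE cardE take_size_cat // mem_enum. Qed.

Lemma flag_proper i : (i < n)%N -> flag i \proper flag i.+1.
Proof.
move=> ltin; have lti : (i < size (enum A ++ enum (~: A)))%N by rewrite size_flag.
have [x0 _] : exists x0 : 'I_n, true.
  by case: (enum A ++ _) lti => // x s _; exists x.
apply/properP; split.
  by apply/subsetP => x; rewrite !inE (take_nth x0) // mem_rcons inE orbC => ->.
exists (nth x0 (enum A ++ enum (~: A)) i).
  by rewrite inE (take_nth x0) // mem_rcons inE eqxx.
rewrite inE; apply/negP => /(nthP x0)[j]; rewrite size_take lti => ltji.
rewrite nth_take // => /eqP; rewrite nth_uniq //; last exact: ltn_trans lti.
by move/eqP=> ji; rewrite ji ltnn in ltji.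
Qed.

(* A chain below (X_i | i \in A) extends by the n - #|A| further steps of the
   flag, and chains in n variables have length at most n. *)
Lemma var_ideal_height : has_height (@var_ideal n K A) #|A|.
Proof.
split.
  exists (fun i => var_ideal (flag i)); split=> [i _|i ltiA|f].
  - exact: var_ideal_prime.
  - apply/var_ideal_strict/flag_proper/(leq_trans ltiA).
    by rewrite -[leqRHS]card_ord max_card.
  - by rewrite flag_card.
move=> k C [pC sC CA].
pose C' i := if (i <= k)%N then C i else var_ideal (flag (#|A| + (i - k))).
have leAn : (#|A| <= n)%N by rewrite -[leqRHS]card_ord max_card.
suff : (k + (n - #|A|) <= n)%N by lia.
apply: (@chain_length _ C') => i lti.
  by rewrite /C'; case: ifP => [/pC//|_]; apply: var_ideal_prime.
have [ltik|leki] := ltnP i k; first by rewrite /C' ltik ltnW //; apply: sC.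
have -> : C' i.+1 = var_ideal (flag (#|A| + (i - k)).+1).
  by rewrite /C' ltnNge leki /= subSn // addnS.
(* At the junction i = k, [C k] agrees with the ideal of [A] only extensionally. *)
have Ci f : C' i f <-> var_ideal (flag (#|A| + (i - k))) f.
  rewrite /C'; case: ifP => // leik.
  have -> : i = k by apply/eqP; rewrite eqn_leq leik.
  by rewrite subnn addn0 flag_card.
have /(@var_ideal_strict n K)[sub [f Ff nFf]] :
    flag (#|A| + (i - k)) \proper flag (#|A| + (i - k)).+1 by apply: flag_proper; lia.
split=> [g /Ci/sub//|]; exists f => //.
by move/Ci.
Qed.

End Flag.

Lemma has_height_ext P Q h : (forall f, P f <-> Q f) -> has_height P h -> has_height Q h.
Proof.
move=> PQ [[C [pC sC CP]] maxh]; split.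
  by exists C; split=> // f; rewrite CP.
by move=> k C' [pC' sC' CQ]; apply: (maxh k C'); split=> // f; rewrite CQ PQ.
Qed.

Lemma has_height_inj P h h' : has_height P h -> has_height P h' -> h = h'.
Proof.
move=> [[C CP] maxh] [[C' C'P] maxh'].
by apply/eqP; rewrite eqn_leq (maxh _ _ C'P) (maxh' _ _ CP).
Qed.

End Dimension.

(** * The associated primes of the edge ideal *)

Section EdgeIdeal.
Variables (K : fieldType) (V : finType) (D : wograph V).
Implicit Types (S H : {set V}) (m : 'X_{1..#|V|}).

(** Divisibility of X^m by a generator: as the ends of an arc differ, it splits into one bound for
    each end. *)
Definition edge_monomial m : bool :=
  [exists a, exists b, [&& arc D a b, 0 < m (enum_rank a) &
                           weight D b <= m (enum_rank b)]]%N.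

Lemma edge_monomialP m : reflect (exists a b, [/\ arc D a b, (0 < m (enum_rank a))%N &
    (weight D b <= m (enum_rank b))%N]) (edge_monomial m).
Proof.
apply: (iffP existsP) => [[a /existsP[b /and3P[]]]|[a [b [ab ma mb]]]].
  by exists a, b.
by exists a; apply/existsP; exists b; rewrite ab ma.
Qed.

Lemma edge_monomial_upclosed : upclosed edge_monomial.
Proof.
move=> m u /edge_monomialP[a [b [ab ma mb]]]; apply/edge_monomialP; exists a, b.
by rewrite !mnmDE !ltn_addr ?leq_addr ?(leq_trans mb) ?leq_addr //; split.
Qed.

Definition arc_exponent a b : 'X_{1..#|V|} :=
  (U_(enum_rank a) + U_(enum_rank b) *+ weight D b)%MM.

Lemma arc_exponentE a b v : arc_exponent a b (enum_rank v) =
  ((a == v) + (b == v) * weight D b)%N.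
Proof.
by rewrite mnmDE mulmnE !mnm1E !(inj_eq enum_rank_inj).
Qed.

Lemma edge_idealE f : edge_ideal D K f <-> mono_ideal edge_monomial f.
Proof.
have monE a b : arc_monomial D K a b = 'X_[arc_exponent a b].
  by rewrite /arc_monomial mpolyXn -mpolyXD.
split=> [|If].
  apply; first exact/mono_ideal_is_ideal/edge_monomial_upclosed.
  move=> g [a [b [ab ->]]]; rewrite monE mono_idealX; apply/edge_monomialP.
  exists a, b; rewrite !arc_exponentE !eqxx mul1n addSn ltn0Sn leq_addl.
  by split.
have idI : is_ideal (edge_ideal D K) := ideal_gen_is_ideal _.
apply: (mono_ideal_gen idI) If => m /edge_monomialP[a [b [ab ma mb]]].
have le_m : (arc_exponent a b <= m)%MM.
  apply/mnm_lepP => i; rewrite -(enum_valK i) arc_exponentE.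
  have [<-|_] := eqVneq a; have [ba|_] := eqVneq b.
  - by rewrite ba arc_irr in ab.
  - by rewrite addn0.
  - by rewrite -ba mul1n.
  - by [].
rewrite -(submK le_m) mpolyXD; apply: (ideal_mull _ idI) => I _; apply.
by exists a, b; rewrite monE.
Qed.

(* S is the complement of the set of variables in an associated prime
   (I(D) : X^m), and H the set of vertices outside S where m is positive; such
   a vertex v has exponent w(v) - 1. *)
Definition assoc_pair S H : Prop :=
  [/\ stable D S, H \subset Vplus D :\: S,
      forall h b, h \in H -> b \in S -> ~~ arc D h b
    & forall c, c \notin S -> (exists2 b, b \in S & arc D c b) \/
        (c \in H \/ weight D c = 1%N) /\ exists2 g, g \in S :|: H & arc D g c].

Definition assoc_set S : Prop := exists H, assoc_pair S H.

Definition primes_of S : {set 'I_#|V|} := enum_rank @: ~: S.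

Lemma primes_ofE S v : (enum_rank v \in primes_of S) = (v \notin S).
Proof. by rewrite (mem_imset _ _ enum_rank_inj) inE. Qed.

Lemma card_primes_of S : #|primes_of S| = (#|V| - #|S|)%N.
Proof. by rewrite (card_imset _ enum_rank_inj) cardsCs setCK. Qed.

Lemma assoc_pair_witness S H : assoc_pair S H ->
  exists m, colon_witness edge_monomial (primes_of S) m.
Proof.
case=> stS /subsetP HV HS cS.
(* On S the exponent meets every demand an arc can make; on H it is positive but one short of the
   weight, so that one more factor X_v completes a generator. *)
pose e v := if v \in S then weight D v else if v \in H then (weight D v).-1 else 0%N.
pose m := [multinom e (enum_val i) | i < #|V|].
have mE v : m (enum_rank v) = e v by rewrite mnmE enum_rankK.
have wS v : v \in S -> e v = weight D v by rewrite /e => ->.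
have wH v : v \in H -> e v = (weight D v).-1 /\ (1 < weight D v)%N.
  move=> vH; have := HV v vH; rewrite !inE => /andP[/negPf vS w1].
  by rewrite /e vS vH; split=> //; have := weight_gt0 D v; lia.
exists m; split=> [u /meetsPn uS|i].
  have u0 v : v \notin S -> u (enum_rank v) = 0%N.
    by move=> vS; apply: uS; rewrite primes_ofE.
  apply/negP => /edge_monomialP[a [b []]]; rewrite !mnmDE !mE => ab.
  have [bS|bS] := boolP (b \in S).
    have [aS|aS] := boolP (a \in S).
      by have := stS a b aS bS; rewrite /adj /= ab.
    rewrite u0 // addn0 /e (negPf aS); case: ifP => // aH.
    by have := HS a b aH bS; rewrite ab.
  rewrite [u (enum_rank b)]u0 // /e (negPf bS).
  by have wb := weight_gt0 D b; move=> _; case: ifP => _; lia.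
rewrite -(enum_valK i) primes_ofE; set c := enum_val i => cNS.
have neq a b : arc D a b -> (a == b) = false.
  by move=> ab; apply/eqP => ab'; rewrite ab' arc_irr in ab.
apply/edge_monomialP; case: (cS c cNS) => [[b bS cb]|[cH [g gSH gc]]].
  exists c, b; rewrite !mnmDE !mE !mnm1E !(inj_eq enum_rank_inj) eqxx (neq c b) //.
  by rewrite (wS b) // addn0 addn1.
exists g, c; rewrite !mnmDE !mE !mnm1E !(inj_eq enum_rank_inj) eqxx [c == g]eq_sym (neq g c) //.
rewrite addn0 addn1; split=> //.
  have [gS|gS] := boolP (g \in S); first by rewrite wS ?weight_gt0.
  by move: gSH; rewrite inE (negPf gS) /= => /wH[->]; lia.
by case: cH => [/wH[-> _]|->] //; lia.
Qed.

Lemma witness_assoc_pair A m : colon_witness edge_monomial A m ->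
  exists2 S, assoc_set S & A = primes_of S.
Proof.
case=> nB BA; pose S := [set v | enum_rank v \notin A].
have AS : A = primes_of S.
  by apply/setP => i; rewrite -(enum_valK i) primes_ofE inE negbK.
exists S => //; pose e v := m (enum_rank v).
have outS v : v \notin S -> enum_rank v \in A by rewrite inE negbK.
pose eS v := if v \in S then weight D v else 0%N.
(* Variables outside [A] may be multiplied in freely without entering the ideal, so exponents on S
   may be raised by the weights. *)
have noarc a b : arc D a b -> (0 < e a + eS a)%N -> (weight D b <= e b + eS b)%N -> False.
  move=> ab ea eb.
  have : ~~ meets A [multinom eS (enum_val i) | i < #|V|].
    by apply/meetsPn => i iA; rewrite mnmE /eS inE enum_valK iA.
  move/nB/edge_monomialP; case; exists a, b.
  by rewrite !mnmDE !mnmE !enum_rankK.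
have U v a : (m + U_(enum_rank v))%MM (enum_rank a) = (e a + (v == a))%N.
  by rewrite mnmDE mnm1E (inj_eq enum_rank_inj).
(* If the exponent of b had already reached its weight, a further factor X_b could complete no new
   generator. *)
have ltw b : b \notin S -> (e b < weight D b)%N.
  move=> bS; rewrite ltnNge; apply/negP => leb; have wb := weight_gt0 D b.
  have /edge_monomialP[a' [b' [ab]]] := BA _ (outS b bS); rewrite !U => ea eb.
  apply: (noarc a' b' ab).
    by case: eqP ea => [<-|]; lia.
  by case: eqP eb => [<-|]; lia.
exists [set v | (v \notin S) && (0 < e v)%N]; split.
- have ns a b : a \in S -> b \in S -> ~~ arc D a b.
    move=> aS bS; apply/negP => ab; apply: (noarc a b ab); rewrite /eS ?aS ?bS.
      by have := weight_gt0 D a; lia.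
    by lia.
  by move=> a b aS bS; rewrite /adj /= negb_or !ns.
- apply/subsetP => v; rewrite !inE => /andP[vS ev].
  by rewrite vS /=; have := ltw v; rewrite inE => /(_ vS); lia.
- move=> h b; rewrite [h \in _]inE => /andP[hS eh] bS; apply/negP => hb.
  by apply: (noarc h b hb); rewrite /eS ?bS; lia.
move=> c cS; have /edge_monomialP[a [b [ab]]] := BA _ (outS c cS); rewrite !U.
have wc := weight_gt0 D c; have ltc := ltw c cS.
(* The factor X_c completes the generator of the arc from a to b. If c = a, then b has full exponent
   and so lies in S; if c = b, then a has positive exponent and so lies in S or H. *)
have [ca|_] := eqVneq c a.
  have [cb|_] := eqVneq c b; first by rewrite -ca -cb arc_irr in ab.
  move=> _; rewrite addn0 => eb; left; exists b; last by rewrite ca.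
  by apply/negPn/negP => /ltw; lia.
have [cb|_] := eqVneq c b; last first.
  by rewrite !addn0 => ea eb; case: (noarc a b ab); lia.
rewrite -cb addn0 => ea ec; right; split; last first.
  by exists a; rewrite ?cb // !inE ea andbT orbN.
have [e0|e0] := posnP (e c); [right; lia | left].
by rewrite inE cS e0.
Qed.

Lemma unmixed_edge_idealP : unmixed (edge_ideal D K) <->
  forall S S', assoc_set S -> assoc_set S' -> #|S| = #|S'|.
Proof.
have upB := edge_monomial_upclosed.
have idE f : mono_ideal edge_monomial f <-> edge_ideal D K f by rewrite edge_idealE.
split=> [unm S S' [H SH] [H' SH']|eqS P Q aP aQ].
  have [m mP] := assoc_pair_witness SH; have [m' mP'] := assoc_pair_witness SH'.
  have aP := eq_assoc_prime idE (witness_assoc K upB mP).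
  have aP' := eq_assoc_prime idE (witness_assoc K upB mP').
  have /(unm _ _ aP aP') hS := var_ideal_height K (primes_of S).
  have := has_height_inj hS (var_ideal_height K (primes_of S')).
  by rewrite !card_primes_of; have [] := (cardsC S, cardsC S'); lia.
have varE R : is_assoc_prime (edge_ideal D K) R ->
    exists2 S, assoc_set S & forall g, R g <-> var_ideal (primes_of S) g.
  move/(eq_assoc_prime edge_idealE)/(assoc_witness upB) => [A [m [mA RA]]].
  by have [S aS AS] := witness_assoc_pair mA; exists S; rewrite -?AS.
have heightE (R : {mpoly K[#|V|]} -> Prop) S h : (forall g, R g <-> var_ideal (primes_of S) g) ->
    has_height R h <-> h = #|primes_of S|.
  move=> RS; have hS := has_height_ext (fun f => iff_sym (RS f))
    (var_ideal_height K (primes_of S)).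
  by split=> [/has_height_inj/(_ hS)|->].
have [[S aS PS] [S' aS' QS']] := (varE _ aP, varE _ aQ).
move=> h; rewrite (heightE _ _ _ PS) (heightE _ _ _ QS') !card_primes_of.
by rewrite (eqS S S').
Qed.

End EdgeIdeal.

(** * Hall's theorem *)

(* Rado's proof: if the Hall condition breaks both on removing u and on removing
   v from r i0, then submodularity of the size of a union contradicts it for r. *)
Lemma hall_marriage (I U : finType) (r : I -> {set U}) :
  (forall X : {set I}, #|X| <= #|\bigcup_(i in X) r i|)%N ->
  exists f : I -> U, injective f /\ forall i, f i \in r i.
Proof.
have [k] := ubnP (\sum_i #|r i|); elim: k r => // k IHk r /ltnSE ler hall.
(* If no set has two elements, all are singletons, distinct by the Hall condition on pairs. *)
have [small|] := boolP [forall i, #|r i| <= 1]%N.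
  have r1 i : exists u, r i == [set u].
    have /cards1P[u ->] : #|r i| == 1%N; last by exists u.
    rewrite eqn_leq (forallP small) /=.
    by have := hall [set i]; rewrite cards1 big_set1.
  have [f fE] : exists f : I -> U, forall i, r i = [set f i].
    by exists (fun i => xchoose (r1 i)) => i; apply/eqP/(xchooseP (r1 i)).
  exists f; split=> [i j eq_f|i]; last by rewrite fE set11.
  apply/eqP/negPn/negP => ij; have := hall [set i; j].
  by rewrite cards2 ij bigcup_setU !big_set1 !fE eq_f setUid cards1.
case/forallPn=> i0; rewrite -ltnNge => /card_gt1P[u [v [ru rv uv]]].
pose r' z i := if i == i0 then r i0 :\ z else r i.
pose N (X : {set I}) := \bigcup_(i in X) r i.
have step z : z \in r i0 ->
    (exists f : I -> U, injective f /\ forall i, f i \in r i) \/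
    exists2 X : {set I}, i0 \notin X & (#|N X :|: (r i0 :\ z)| <= #|X|)%N.
  move=> rz; have [/forallP hall'|/forallPn[X]] :=
    boolP [forall X : {set I}, (#|X| <= #|\bigcup_(i in X) r' z i|)%N].
    left; have [|//|f [f_inj fr]] := IHk (r' z).
      apply: leq_trans ler; rewrite (bigD1 i0) //= [ltnRHS](bigD1 i0) //=.
      rewrite /r' eqxx (cardsD1 z (r i0)) rz add1n addSn ltnS leq_add2l.
      by apply: leq_sum => i /negPf->.
    exists f; split=> // i; have := fr i; rewrite /r'; case: eqP => // -> .
    by rewrite inE => /andP[].
  (* A set violating the condition for [r' z] contains i0, for otherwise it would violate it for
     [r]. *)
  rewrite -ltnNge => ltX; right; have [X0|X0] := boolP (i0 \in X); last first.
    have := hall X; rewrite leqNgt => /negP[]; apply: leq_trans ltX.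
    rewrite ltnS; apply: eq_leq; congr #|pred_of_set _|; apply: eq_bigr => i Xi.
    by rewrite /r'; case: eqP => // ii0; rewrite -ii0 Xi in X0.
  exists (X :\ i0); first by rewrite !inE eqxx.
  rewrite (cardsD1 i0) X0 add1n ltnS in ltX; apply: leq_trans ltX.
  apply: eq_leq; congr #|pred_of_set _|; rewrite (big_setD1 i0) //= setUC /r' eqxx.
  by congr (_ :|: _); apply: eq_bigr => i; rewrite !inE => /andP[/negPf->].
have [//|[X X0 leX]] := step u ru; have [//|[Y Y0 leY]] := step v rv.
suff : (#|X| + #|Y| < #|N X :|: (r i0 :\ u)| + #|N Y :|: (r i0 :\ v)|)%N.
  by rewrite ltnNge leq_add.
(* As u and v differ, the union of the two sets contains all of r i0, hence N of i0 together with X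
   and Y. This supplies the extra 1. *)
rewrite -[ltnRHS]cardsUI -cardsUI.
have sub1 : N (i0 |: (X :|: Y)) \subset
    (N X :|: (r i0 :\ u)) :|: (N Y :|: (r i0 :\ v)).
  apply/bigcupsP => i; rewrite !inE => /or3P[/eqP->|iX|iY]; apply/subsetP => w rw.
  - rewrite !inE rw !andbT; have [wu|] := eqVneq w u; last by rewrite !orbT.
    by rewrite wu uv !orbT.
  - by rewrite !inE (_ : w \in N X) //; apply/bigcupP; exists i.
  - by rewrite !inE (_ : w \in N Y) ?orbT //; apply/bigcupP; exists i.
have sub2 : N (X :&: Y) \subset
    (N X :|: (r i0 :\ u)) :&: (N Y :|: (r i0 :\ v)).
  apply/bigcupsP => i; rewrite inE => /andP[iX iY]; apply/subsetP => w rw.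
  have inN (Z : {set I}) : i \in Z -> w \in N Z by move=> iZ; apply/bigcupP; exists i.
  by rewrite !in_setI !in_setU !inN.
have := leq_trans (hall _) (subset_leq_card sub1).
have := leq_trans (hall _) (subset_leq_card sub2).
rewrite cardsU1 inE negb_or X0 Y0 /=.
by set p := #|_ :&: Y|; set q := #|_ :|: Y|; lia.
Qed.

(** * Matchings and associated sets *)

Section Combinatorics.
Variables (V : finType) (D : wograph V).
Implicit Types (S F : {set V}).

Lemma adjC u v : adj D u v = adj D v u.
Proof. by rewrite /adj /= orbC. Qed.

Lemma adj_irr u : adj D u u = false.
Proof. by rewrite /adj /= arc_irr. Qed.

Lemma arc_adj u v : arc D u v -> adj D u v.
Proof. by rewrite /adj /= => ->. Qed.

Lemma in_Nbr u v : (v \in Nbr D u) = adj D u v.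
Proof. by rewrite !inE. Qed.

Lemma assoc_set_stable S : assoc_set D S -> stable D S.
Proof. by case=> H []. Qed.

Lemma stable2 u v : ~~ adj D u v -> stable D [set u; v].
Proof.
by move=> uv y z; rewrite !inE => /orP[]/eqP-> /orP[]/eqP->; rewrite ?adj_irr // adjC.
Qed.

(* S is a maximal stable set containing S0 among those avoiding the
   out-neighbours of F; then the vertices of F can be taken in H. *)
Lemma assoc_set_extend S0 F : stable D S0 -> F \subset Vplus D ->
  (forall f b, f \in F -> b \in S0 -> ~~ arc D f b) ->
  (forall f, f \in F -> (exists2 b, b \in S0 & adj D f b) \/
                        (exists2 g, g \in F & arc D g f)) ->
  exists S, [/\ assoc_set D S, S0 \subset S &
                forall f b, f \in F -> arc D f b -> b \notin S].
Proof.
move=> stS0 /subsetP FV FS0 nbrF.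
pose P := [pred S : {set V} | [forall u in S, forall v in S, ~~ adj D u v] &&
                     [forall f in F, forall b in S, ~~ arc D f b]].
have PP S : reflect (stable D S /\ forall f b, f \in F -> b \in S -> ~~ arc D f b) (P S).
  apply: (iffP andP) => [[st FS]|[st FS]]; split.
  - by move=> u v uS vS; move/forall_inP: st => /(_ u uS)/forall_inP; apply.
  - by move=> f b fF bS; move/forall_inP: FS => /(_ f fF)/forall_inP; apply.
  - by apply/forall_inP => u uS; apply/forall_inP => v vS; apply: st.
  - by apply/forall_inP => f fF; apply/forall_inP => b bS; apply: FS.
have [S /maxsetP[/PP[stS FS] maxS] sS0S] : {S | maxset P S & S0 \subset S}.
  by apply: maxset_exists; apply/PP.
have FnS f : f \in F -> f \notin S.
  move=> fF; apply/negP => fS; case: (nbrF f fF) => [[b bS0]|[g gF gf]].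
    by apply/negP/stS => //; apply: (subsetP sS0S).
  by have := FS g f gF fS; rewrite gf.
exists S; split=> // [|f b fF fb]; last first.
  by apply/negP => bS; have := FS f b fF bS; rewrite fb.
(* The largest H that the second and third clauses of [assoc_pair] allow; it contains F. *)
exists [set v | [&& v \notin S, v \in Vplus D & [forall b in S, ~~ arc D v b]]].
split=> //.
- by apply/subsetP => v; rewrite !inE => /and3P[-> ->].
- by move=> h b; rewrite inE => /and3P[_ _ /forall_inP]; apply.
move=> c cS; have [/existsP[b /andP[bS cb]]|nocS] := boolP [exists b in S, arc D c b].
  by left; exists b.
right; have cout : [forall b in S, ~~ arc D c b].
  by apply/forall_inP => b bS; apply: contraNN nocS => cb; apply/existsP; exists b; rewrite bS.
split; first by rewrite !inE cS cout andbT; case: eqP; [right | left].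
have [/existsP[f /andP[fF fc]]|nF] := boolP [exists f in F, arc D f c].
  exists f => //; rewrite !inE FnS //=; have := FV f fF; rewrite inE => ->.
  by rewrite orbC /=; apply/orP; left; apply/forall_inP => b; apply: FS.
suff [g gS gc] : exists2 g, g \in S & arc D g c by exists g; rewrite // inE gS.
have [/existsP[g /andP[gS gc]]|nS] := boolP [exists g in S, arc D g c]; first by exists g.
(* With no neighbour in S and no in-neighbour in F, c could be added to S, against maximality. *)
have : c |: S = S.
  apply: maxS; last exact: subsetU1.
  have nadj v : v \in S -> ~~ adj D c v.
    move=> vS; rewrite /adj /= negb_or (forall_inP cout) //=.
    by apply: contraNN nS => vc; apply/existsP; exists v; rewrite vS.
  apply/PP; split.
    move=> u v; rewrite !inE => /predU1P[->|uS] /predU1P[->|vS].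
    - by rewrite adj_irr.
    - exact: nadj.
    - by rewrite adjC nadj.
    - exact: stS.
  move=> f b fF; rewrite !inE => /predU1P[->|bS]; last exact: FS.
  by apply: contraNN nF => fc; apply/existsP; exists f; rewrite fF.
by move/setP/(_ c); rewrite !inE eqxx (negPf cS).
Qed.

Lemma stable_extend S0 : stable D S0 -> exists2 S, assoc_set D S & S0 \subset S.
Proof.
move=> stS0; have [|||S [aS sS _]] := @assoc_set_extend S0 set0 stS0; last by exists S.
- exact: sub0set.
- by move=> f b; rewrite inE.
- by move=> f; rewrite inE.
Qed.

(** * Sizes of stable and associated sets in a labelled graph *)

Section Labelled.
Variables (s : nat) (x : bool -> 'I_s -> V).

(** A perfect matching in indexed form: [x] is a bijection onto the vertices that pairs adjacent
    ones. *)
Definition labelling : Prop :=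
  [/\ forall k k' i j, x k i = x k' j -> k = k' /\ i = j,
      forall v, exists k i, v = x k i
    & forall i, adj D (x false i) (x true i)].

Hypothesis lab : labelling.

Lemma labelling_adj k i : adj D (x k i) (x (~~ k) i).
Proof. by case: lab => _ _ ax; case: k; rewrite // adjC. Qed.

(** A stable set contains at most one end of each matching edge; [h] selects that end. *)
Lemma stable_card S : stable D S ->
  #|S| = #|[set i | (x false i \in S) || (x true i \in S)]|.
Proof.
move=> stS; have [injx surjx _] := lab.
pose h i := x (x false i \notin S) i.
have inj_h : injective h by move=> i j /injx[].
rewrite -(card_imset _ inj_h); congr #|pred_of_set _|; apply/setP => v.
apply/idP/imsetP => [vS|[i]]; last first.
  by rewrite inE /h => iS ->; case: (boolP (x false i \in S)) iS.
have [k [i vE]] := surjx v; exists i.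
  by rewrite inE; case: k vE => <-; rewrite vS ?orbT.
case: k vE => vE; rewrite /h; last by rewrite -vE vS.
suff /negPf -> : x false i \notin S by [].
by apply/negP => fS; have := stS _ _ fS vS; rewrite vE (labelling_adj false).
Qed.

Lemma stable_meets_pairs S : stable D S -> #|S| = s ->
  forall k i, x k i \notin S -> x (~~ k) i \in S.
Proof.
move=> stS; rewrite stable_card // => cS k i nS.
have : i \in [set i | (x false i \in S) || (x true i \in S)].
  apply/negPn/negP => ni; suff : (s < s)%N by rewrite ltnn.
  rewrite -[X in (X < _)%N]cS -[X in (_ < X)%N]card_ord; apply: proper_card.
  by apply/properP; split; [apply/subsetP | exists i].
by rewrite inE; case: k nS => /negPf->; rewrite ?orbF.
Qed.

(** If S missed both ends of a matching edge, each end would have a neighbour in S, and transitivity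
    would make these two neighbours adjacent. *)
Lemma assoc_set_card S : matching_condition D x -> weight_condition D x ->
  assoc_set D S -> #|S| = s.
Proof.
move=> [_ _ stx condx] weightx [H [stS HV HS cS]].
have [injx surjx _] := lab.
have stk k i j : ~~ adj D (x k i) (x k j) by apply: (stx k); apply: imset_f.
(* Read backwards, the transitivity condition also holds with the superscripts exchanged. *)
have symx k i j l : adj D (x k j) (x (~~ k) i) -> adj D (x k i) (x (~~ k) l) ->
    adj D (x k j) (x (~~ k) l).
  by case: k => /= ji il; [rewrite adjC; apply: (condx i l j); rewrite adjC | apply: condx il].
have other k i v : adj D (x k i) v -> exists j, v = x (~~ k) j.
  have [k' [j ->]] := surjx v; case: k' k => -[]; try by exists j.
  - by rewrite (negPf (stk _ _ _)).
  - by rewrite (negPf (stk _ _ _)).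
  (* By the weight condition at h, every neighbour of the partner of x k i is an out-neighbour of h,
     hence outside S, and no vertex of V+ points to the partner. Neither alternative of [cS] is then
     left for it. *)
  have HinS h k i : h \in H -> arc D h (x k i) -> x (~~ k) i \in S.
    move=> hH hp; have [j hE] : exists j, h = x (~~ k) j.
      by apply: (other k i); rewrite adjC; apply: arc_adj.
    have := subsetP HV h hH; rewrite !inE => /andP[hS /eqP wh].
    pose L := [set l | arc D h (x k l)].
    have NL : Nout D (x (~~ k) j) = [set x (~~ ~~ k) l | l in L].
      apply/setP => v; rewrite inE -hE negbK; apply/idP/imsetP => [hv|[l]].
        have [l vE] : exists l, v = x (~~ ~~ k) l.
          by apply: (other _ j); rewrite -hE; apply: arc_adj.
        by rewrite negbK in vE; exists l; rewrite // inE -vE.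
      by rewrite inE => hl ->.
    rewrite hE in wh; have [|sub noin] := weightx (~~ k) j L wh NL i; first by rewrite inE.
    have nadjS v : adj D (x (~~ k) i) v -> v \notin S.
      have /subsetP/(_ v) := sub; rewrite in_Nbr inE -hE => + adjv => /(_ adjv) hv.
      by apply/negP => /(HS h v hH); rewrite hv.
    apply/negPn/negP => /cS[[b bS qb]|[_ [g + gq]]].
      by have := nadjS b (arc_adj qb); rewrite bS.
    rewrite inE => /orP[gS|gH].
      by have := nadjS g; rewrite adjC (arc_adj gq) gS => /(_ isT).
    have := subsetP HV g gH; rewrite inE => /andP[_ gV].
    by move/setP/(_ g): noin; rewrite inE gV andbT !inE gq.
  have Snbr k i : x k i \notin S -> x (~~ k) i \notin S ->
      exists2 j, x (~~ k) j \in S & adj D (x k i) (x (~~ k) j).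
    move=> pS qS; suff [b bS pb] : exists2 b, b \in S & adj D (x k i) b.
      by have [j bE] := other _ _ _ pb; exists j; rewrite -bE.
    case: (cS _ pS) => [[b bS pb]|[_ [g + gp]]]; first by exists b; rewrite ?arc_adj.
    rewrite inE => /orP[gS|gH]; first by exists g; rewrite // adjC arc_adj.
    by rewrite (HinS g) in qS.
rewrite (stable_card stS) -[RHS]card_ord -cardsT; congr #|pred_of_set _|.
apply/setP => i; rewrite !inE; apply/negPn/negP; rewrite negb_or => /andP[pS qS].
have [j jS pj] := Snbr false i pS qS; have [l lS ql] := Snbr true i qS pS.
have := stS _ _ lS jS; rewrite (symx false i l j) //; by rewrite adjC.
Qed.

End Labelled.

Lemma matching_labelling s (x : bool -> 'I_s -> V) :
  matching_condition D x -> labelling x.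
Proof.
case=> inj_pair [/subsetP sub triv cov] stx _.
have ax i : adj D (x false i) (x true i).
  have /sub/imsetP[[a b]] : matched_pair x i \in [set matched_pair x i | i : 'I_s].
    exact: imset_f.
  rewrite inE /= => ab E.
  have aP : a \in matched_pair x i by rewrite E set21.
  have bP : b \in matched_pair x i by rewrite E set22.
  move: aP bP; rewrite !inE.
  move=> /orP[]/eqP aE /orP[]/eqP bE.
  - by move: ab; rewrite aE bE arc_irr.
  - by rewrite -aE -bE arc_adj.
  - by rewrite -aE -bE adjC arc_adj.
  - by move: ab; rewrite aE bE arc_irr.
have in_pair k i : x k i \in matched_pair x i.
  by case: k; rewrite !inE eqxx ?orbT.
split=> // [k k' i j E|v].
  have ij : i = j.
    apply: inj_pair; apply/eqP/negPn/negP => ne.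
    have /trivIsetP/(_ _ _ (imset_f _ isT) (imset_f _ isT) ne) := triv.
    by rewrite disjoint_subset => /subsetP/(_ _ (in_pair k i)); rewrite inE E in_pair.
  split=> //; subst j; have := ax i.
  by case: k k' E => -[] // ->; rewrite adj_irr.
have : v \in cover [set matched_pair x i | i : 'I_s] by rewrite cov inE.
case/bigcupP=> _ /imsetP[i _ ->]; rewrite !inE => /orP[]/eqP->.
  by exists false, i.
by exists true, i.
Qed.

(** A vertex outside [A] has a neighbour, necessarily in [A]; so [A] is a maximal stable set and its
    extension is [A] itself. *)
Lemma side_assoc (A B : {set V}) : (forall u, Nbr D u != set0) ->
  stable D A -> stable D B -> A :|: B = [set: V] -> assoc_set D A.
Proof.
move=> noiso stA stB AB; have [S aS /subsetP AS] := stable_extend stA.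
suff <- : S = A by [].
apply/setP => v; apply/idP/idP => [vS|/AS//]; apply/negPn/negP => vA.
have [u] := set0Pn _ (noiso v); rewrite in_Nbr => vu.
have inB w : w \notin A -> w \in B.
  by move=> wA; have /setP/(_ w) := AB; rewrite !inE (negPf wA).
have [/AS uS|/inB uB] := boolP (u \in A).
  by have := assoc_set_stable aS vS uS; rewrite vu.
by have := stB v u (inB v vA) uB; rewrite vu.
Qed.

(** With N the neighbourhood of X, the union of X and B minus N is stable and extends to an
    associated set of size #|B|; hence X is no larger than N. *)
Lemma bipartite_hall (A B : {set V}) : stable D A -> stable D B ->
  A :|: B = [set: V] -> [disjoint A & B] ->
  (forall S, assoc_set D S -> #|S| = #|B|) ->
  forall X : {set V}, X \subset A -> (#|X| <= #|\bigcup_(u in X) Nbr D u|)%N.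
Proof.
move=> stA stB AB disAB eqS X XA; set N := \bigcup_(u in X) _.
have [|S aS sub] := @stable_extend (X :|: (B :\: N)).
  have XN u v : u \in X -> v \notin N -> ~~ adj D u v.
    by move=> uX; apply: contraNN => uv; apply/bigcupP; exists u; rewrite ?in_Nbr.
  move=> u v; rewrite !inE => /orP[uX|/andP[uN uB]] /orP[vX|/andP[vN vB]].
  - by apply: stA; apply: (subsetP XA).
  - exact: XN.
  - by rewrite adjC XN.
  - exact: stB.
have := subset_leq_card sub; rewrite (eqS S aS) cardsU.
have -> : X :&: (B :\: N) = set0.
  apply/setP => u; rewrite !inE; apply/negP => /and3P[/(subsetP XA) uA _ uB].
  by move: disAB; rewrite disjoint_subset => /subsetP/(_ u uA); rewrite inE uB.
have := subset_leq_card (subsetIr B N); have := cardsID N B.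
rewrite cards0; lia.
Qed.

Lemma bipartite_labelling (A B : {set V}) : stable D A -> stable D B ->
  A :|: B = [set: V] -> [disjoint A & B] -> assoc_set D A ->
  (forall S, assoc_set D S -> #|S| = #|B|) ->
  exists x : bool -> 'I_#|A| -> V,
    labelling x /\ forall k i, x k i \in (if k then B else A).
Proof.
move=> stA stB AB disAB aA eqS.
have [|f [inj_f fN]] := @hall_marriage 'I_#|A| V (fun i => Nbr D (enum_val i)).
  move=> X; have := bipartite_hall stA stB AB disAB eqS.
  move=> /(_ [set enum_val i | i in X]); rewrite card_imset; last exact: enum_val_inj.
  move/(_ _)/leq_trans; apply.
    by apply/subsetP => _ /imsetP[i _ ->]; apply: enum_valP.
  apply: subset_leq_card; apply/bigcupsP => _ /imsetP[i iX ->].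
  exact: (bigcup_sup i).
have fB i : f i \in B.
  have := fN i; rewrite in_Nbr => af; have /setP/(_ (f i)) := AB.
  rewrite !inE; case: (boolP (f i \in A)) => //= fA _.
  by have := stA _ _ (enum_valP i) fA; rewrite af.
(* [A] is itself an associated set, so it has as many elements as [B] and the injection is onto. *)
have fBE : f @: setT = B.
  apply/eqP; rewrite eqEcard card_imset // cardsT card_ord -(eqS A aA) leqnn andbT.
  by apply/subsetP => _ /imsetP[i _ ->].
have notAB u : u \in A -> u \in B -> False.
  by move=> uA uB; move: disAB; rewrite disjoint_subset => /subsetP/(_ u uA); rewrite inE uB.
exists (fun k i => if k then f i else enum_val i); split; last first.
  by case=> i //; apply: enum_valP.
split=> [[] [] i j|v|i]; first by move/inj_f.
- by move=> E; case: (notAB (f i)) => //; rewrite E enum_valP.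
- by move=> E; case: (notAB (f j)) => //; rewrite -E enum_valP.
- by move/enum_val_inj.
- have /setP/(_ v) := AB; rewrite !inE => /orP[vA|].
    by exists false, (enum_rank_in vA v); rewrite enum_rankK_in.
  by rewrite -fBE => /imsetP[i _ ->]; exists true, i.
- by have := fN i; rewrite in_Nbr.
Qed.

(** * The two conditions from the equality of sizes *)

Section LabelledUnmixed.
Variables (s : nat) (x : bool -> 'I_s -> V).
Hypothesis lab : labelling x.
Hypothesis stx : forall k i j, ~~ adj D (x k i) (x k j).
Hypothesis eqS : forall S, assoc_set D S -> #|S| = s.

Lemma assoc_set_meets_pair S k i : assoc_set D S -> x k i \notin S -> x (~~ k) i \in S.
Proof.
by move=> aS; apply: stable_meets_pairs => //; [apply: assoc_set_stable | apply: eqS].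
Qed.

Lemma labelling_matching : matching_condition D x.
Proof.
have [injx surjx ax] := lab.
have pairI v i j : v \in matched_pair x i -> v \in matched_pair x j -> i = j.
  by rewrite !inE => /orP[]/eqP-> /orP[]/eqP/injx[].
split.
- by move=> i j E; apply: (pairI (x false i)); rewrite -?E set21.
- split.
  + apply/subsetP => _ /imsetP[i _ ->]; apply/imsetP.
    have /orP[ab|ba] := ax i; [exists (x false i, x true i) | exists (x true i, x false i)];
      by rewrite ?inE //= setUC.
  + apply/trivIsetP => _ _ /imsetP[i _ ->] /imsetP[j _ ->] ne.
    rewrite disjoint_subset; apply/subsetP => v vi; rewrite inE.
    by apply: contraNN ne => vj; rewrite (pairI v i j).
  + apply/setP => v; rewrite inE; apply/bigcupP; have [k [i ->]] := surjx v.
    exists (matched_pair x i); first exact: imset_f.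
    by case: k; rewrite !inE eqxx ?orbT.
- by move=> k _ _ /imsetP[i _ ->] /imsetP[j _ ->].
(* Were the two outer vertices not adjacent, an associated set containing both would miss both ends
   of edge i. *)
move=> i j k ji ik; apply/negPn/negP => njk.
have [S aS sS] := stable_extend (stable2 njk); have stS := assoc_set_stable aS.
have jS := subsetP sS _ (set21 _ _); have kS := subsetP sS _ (set22 _ _).
have /(assoc_set_meets_pair aS) iS : x false i \notin S.
  by apply/negP => iS; have := stS _ _ iS kS; rewrite ik.
by have := stS _ _ jS iS; rewrite ji.
Qed.

Lemma labelling_weight : (forall v, source D v -> weight D v = 1%N) ->
  weight_condition D x.
Proof.
move=> srcw k j L wh NL i iL; have [injx surjx ax] := lab.
set h := x k j in wh NL *; set q := x k i.
have hp : arc D h (x (~~ k) i).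
  by have /setP/(_ (x (~~ k) i)) := NL; rewrite inE imset_f.
have negE (b c : bool) : b != c -> b = ~~ c by case: b c => -[].
have other v l : adj D (x k l) v -> exists l', v = x (~~ k) l'.
  have [k' [l' ->]] := surjx v; have [->|kk'] := eqVneq k' k.
    by rewrite (negPf (stx _ _ _)).
  by exists l'; rewrite (negE _ _ kk').
have st' l l' : ~~ adj D (x (~~ k) l) (x (~~ k) l') by [].
(* As its weight is not 1, h is not a source. Its in-neighbour g, placed in S, lets h serve as an
   element of F in [assoc_set_extend]. *)
have [g gh] : exists g, arc D g h.
  have /eqP/setP nsrc : ~~ source D h by apply: contra_notN wh => /srcw.
  have /set0Pn[g] : Nin D h != set0.
    by apply: contra_notN nsrc => /eqP E v; rewrite /Nbr E setU0.
  by rewrite inE; exists g.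
have [lg gE] : exists l, g = x (~~ k) l by apply: (other _ j); rewrite adjC arc_adj.
have nhg : ~~ arc D h g by apply: arc_asym.
have hV : h \in Vplus D by rewrite inE; apply/eqP.
have sub : Nbr D q \subset Nout D h.
  apply/subsetP => y; rewrite in_Nbr inE => qy; apply/negPn/negP => nhy.
  have [ly yE] := other y i qy.
  (* S misses x (~~ k) i, an out-neighbour of h, and also its partner q, a neighbour of y. *)
  have [|||f|S [aS sS outS]] := @assoc_set_extend [set y; g] [set h].
  - by apply: stable2; rewrite yE gE.
  - by rewrite sub1set.
  - by move=> f b; rewrite !inE => /eqP-> /orP[]/eqP->.
  - by rewrite inE => /eqP->; left; exists g; rewrite ?set22 // adjC arc_adj.
  have yS := subsetP sS _ (set21 _ _).
  have pS := outS _ _ (set11 h) hp.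
  have := assoc_set_meets_pair aS pS; rewrite negbK => qS.
  by have := assoc_set_stable aS qS yS; rewrite qy.
split=> //; apply/setP => r; rewrite [RHS]inE; apply/negP.
rewrite inE => /andP[]; rewrite inE => rq rV.
have qr : adj D q r by rewrite adjC arc_adj.
have [lr rE] := other r i qr.
have hr : arc D h r by have := subsetP sub r; rewrite in_Nbr inE; apply.
(* Here S misses x (~~ k) i because of h and q because of r; the arc from h to r admits r into F. *)
have [|||f|S [aS sS outS]] := @assoc_set_extend [set g] [set h; r].
- by rewrite -[[set g]]setUid; apply: stable2; rewrite adj_irr.
- by apply/subsetP => f; rewrite in_set2 => /orP[]/eqP->.
- move=> f b; rewrite !inE => /orP[]/eqP-> /eqP-> //.
  by apply: contraNN (st' lr lg) => rg; rewrite -rE -gE arc_adj.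
- rewrite !inE => /orP[]/eqP->.
    by left; exists g; rewrite ?set11 // adjC arc_adj.
  by right; exists h; rewrite ?set21.
have := assoc_set_meets_pair aS (outS _ _ (set21 h r) hp).
by rewrite negbK => qS; have := outS _ _ (set22 h r) rq; rewrite qS.
Qed.

End LabelledUnmixed.
End Combinatorics.

Theorem theorem4p17 (K : fieldType) (V : finType) (D : wograph V)
  (source_weight : forall x : V, source D x -> weight D x = 1%N)
  (no_isolated : forall x : V, Nbr D x != set0)
  (bipartiteD : bipartite D) :
  unmixed (edge_ideal D K) <->
  exists (s : nat) (x : bool -> 'I_s -> V),
    matching_condition D x /\ weight_condition D x.
Proof.
apply: iff_trans (unmixed_edge_idealP K D) _; split=> [eqS|[s [x [Mx Wx]]] S S' aS aS'].
  have [A [B [stA stB AB disAB]]] := bipartiteD.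
  have aA := side_assoc no_isolated stA stB AB.
  have aB : assoc_set D B by apply: (side_assoc no_isolated stB stA); rewrite setUC.
  have [x [lab xAB]] := bipartite_labelling stA stB AB disAB aA (fun S aS => eqS _ _ aS aB).
  have stx k i j : ~~ adj D (x k i) (x k j).
    by have := (xAB k i, xAB k j); case: k => -[]; [apply: stB | apply: stA].
  have eqA S : assoc_set D S -> #|S| = #|A| by move=> aS; apply: eqS.
  exists #|A|, x; split; first exact: labelling_matching.
  exact: labelling_weight.
have lab := matching_labelling Mx.
by rewrite (assoc_set_card lab Mx Wx aS) (assoc_set_card lab Mx Wx aS').
Qed.
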